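(* For all integers $d\ge 1$ and $n\ge d+1$, we have $\mathrm{OT}^*_d(n)\ge \operatorname{twr}_d(n-d)$.
   Context: The sign of an ordered $(j+1)$-tuple $(q_1,\dots,q_{j+1})$ of points in $\mathbb{R}^j$ is $\operatorname{sgn}\det M$, where $M$ is the $(j+1)\times(j+1)$ matrix whose $i$th column is $(1,q_{i,1},\dots,q_{i,j})$. A sequence $(q_1,\dots,q_n)$ in $\mathbb{R}^j$ is order-type homogeneous if all $(j+1)$-tuples $(q_{i_1},\dots,q_{i_{j+1}})$ with $i_1<\dots<i_{j+1}$ have the same sign, this sign being nonzero. Let $\pi_j:\mathbb{R}^d\to\mathbb{R}^j$ be the projection to the first $j$ coordinates. A sequence $P=(p_1,\dots,p_n)$ in $\mathbb{R}^d$ is super-order-type homogeneous if for every $j=1,\dots,d$ the sequence $(\pi_j(p_1),\dots,\pi_j(p_n))$ is order-type homogeneous. A point set in $\mathbb{R}^d$ is in general position if no $d+1$ of its points lie on a common hyperplane. $\mathrm{OT}^*_d(n)$ denotes the smallest $N$ such that every sequence of $N$ points in general position in $\mathbb{R}^d$ contains a super-order-type homogeneous subsequence of length $n$. The tower function is $\operatorname{twr}_1(x)=x$, $\operatorname{twr}_{i+1}(x)=2^{\operatorname{twr}_i(x)}$. *)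

(* Defs.v *)
From mathcomp Require Import all_boot all_order all_algebra.
From mathcomp Require Import boolp reals.

Set Implicit Arguments.
Unset Strict Implicit.
Unset Printing Implicit Defensive.

Import Order.TTheory GRing.Theory Num.Theory.
Local Open Scope ring_scope.

Definition increasing (m n : nat) (s : 'I_m -> 'I_n) : Prop :=
  forall a b : 'I_m, (a < b)%N -> (s a < s b)%N.

(* Row [ord0] is constantly 1; row [lift ord0 k] lists the [k]-th coordinates. *)
Definition homog_matrix (R : realType) (j m : nat) (q : 'I_m -> 'rV[R]_j) :
    'M[R]_(j.+1, m) :=
  \matrix_(r, c) (if unlift ord0 r is Some k then q c 0 k else 1).

Definition tuple_sign (R : realType) (j : nat) (q : 'I_j.+1 -> 'rV[R]_j) : R :=
  Num.sg (\det (homog_matrix q)).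

Definition ot_homogeneous (R : realType) (j n : nat) (q : 'I_n -> 'rV[R]_j) :
    Prop :=
  exists s : R, s != 0 /\
    forall t : 'I_j.+1 -> 'I_n, increasing t ->
      tuple_sign (fun a => q (t a)) = s.

Definition proj (R : realType) (d j : nat) (hj : (j <= d)%N) (x : 'rV[R]_d) :
    'rV[R]_j :=
  \row_k x 0 (widen_ord hj k).

Definition super_ot_homogeneous (R : realType) (d n : nat)
    (p : 'I_n -> 'rV[R]_d) : Prop :=
  forall (j : nat) (hj : (j <= d)%N), (1 <= j)%N ->
    ot_homogeneous (fun i => proj hj (p i)).

Definition on_hyperplane (R : realType) (d : nat) (a : 'rV[R]_d) (b : R)
    (x : 'rV[R]_d) : Prop :=
  \sum_k a 0 k * x 0 k = b.

(* The [d + 1] points are chosen by their indices, so a repeated point is     *)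
(* excluded as soon as the sequence has at least [d + 1 >= 2] terms.          *)
Definition general_position (R : realType) (d N : nat) (p : 'I_N -> 'rV[R]_d) :
    Prop :=
  forall A : {set 'I_N}, #|A| = d.+1 ->
    ~ exists (a : 'rV[R]_d) (b : R),
        a != 0 /\ forall i, i \in A -> on_hyperplane a b (p i).

Definition forces_super_ot (R : realType) (d n N : nat) : Prop :=
  forall p : 'I_N -> 'rV[R]_d, general_position p ->
    exists s : 'I_n -> 'I_N,
      increasing s /\ super_ot_homogeneous (fun i => p (s i)).

(* The lemmas up to [forces_super_ot_exists] show, by Ramsey's theorem for    *)
(* hypergraphs, that the minimum defining [OTstar] is taken over a nonempty   *)
(* set.                                                                       *)

Definition mono (T : eqType) (C : Type) (k : nat) (chi : seq T -> C)
    (L : seq T) : Prop :=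
  exists c, forall t, subseq t L -> size t = k -> chi t = c.

Lemma mono_sub (T : eqType) (C : Type) k (chi : seq T -> C) L L' :
  subseq L' L -> mono k chi L -> mono k chi L'.
Proof.
by move=> sL [c Hc]; exists c => t st; apply: Hc; apply: subseq_trans st sL.
Qed.

Fixpoint prehom (T : eqType) (C : Type) (k : nat) (chi : seq T -> C)
    (P : seq (T * C)) : Prop :=
  if P is xc :: P' then
    (forall t, subseq t (map fst P') -> size t = k -> chi (xc.1 :: t) = xc.2)
    /\ prehom k chi P'
  else True.

Lemma prehom_filter (T C : eqType) k (chi : seq T -> C) P a :
  prehom k chi P -> prehom k chi (filter a P).
Proof.
elim: P => //= xc P IH [H /IH HP]; case: ifP => //= _; split=> // t st.
by apply: H; apply: (subseq_trans st); apply: map_subseq; exact: filter_subseq.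
Qed.

Lemma prehom_mono (T C : eqType) k (chi : seq T -> C) P c :
  prehom k chi P -> all (fun xc => xc.2 == c) P -> mono k.+1 chi (map fst P).
Proof.
move=> HP aP; exists c; elim: P HP aP => [_ _ t /eqP -> //|xc P IH].
move=> /= [H HP] /andP [/eqP xcc aP] [//|y t].
rewrite [subseq _ _]/=; case: eqP => [-> st [szt]|_ st]; last exact: IH.
by rewrite H.
Qed.

Lemma ramsey (C : finType) (k : nat) : forall n, exists N,
  forall (T : eqType) (chi : seq T -> C) (L : seq T), (N <= size L)%N ->
  exists L', [/\ subseq L' L, size L' = n & mono k chi L'].
Proof.
elim: k => [|k IHk] n.
  exists n => T chi L nL; exists (take n L); split; first exact: take_subseq.
    by rewrite size_takel.
  by exists (chi [::]) => -[].
have pre m : exists N, forall (T : eqType) (chi : seq T -> C) (L : seq T),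
    (N <= size L)%N -> exists P, [/\ subseq (map fst P) L, size P = m
      & prehom k chi P].
  elim: m => [|m [N HN]]; first by exists 0 => T chi L _; exists [::]; rewrite sub0seq.
  have [N' HN'] := IHk N; exists N'.+1 => T chi [//|x L] /=; rewrite ltnS => sz.
  have [L1 [s1 z1 [c Hc]]] := HN' _ (fun t => chi (x :: t)) L sz.
  have [|P [sP zP HP]] := HN _ chi L1; first by rewrite z1.
  exists ((x, c) :: P); split => /=.
  - by rewrite eqxx; apply: subseq_trans s1.
  - by rewrite zP.
  - by split=> // t st; apply: Hc; apply: subseq_trans sP.
have [N HN] := pre (#|C| * n).+1; exists N => T chi L /(HN _ chi) [P [sP zP HP]].
have [c Hc] : exists c, (n <= count (fun xc => xc.2 == c) P)%N.
  apply/existsP; apply: contraT => /existsPn nc.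
  suff : (size P <= #|C| * n)%N by rewrite zP ltnn.
  have -> : size P = (\sum_c count (fun xc : T * C => xc.2 == c) P)%N.
    elim: P {sP zP HP nc} => /= [|xc P ->]; first by rewrite big1.
    rewrite big_split /= -add1n; congr (_ + _)%N.
    rewrite (bigD1 xc.2) //= eqxx big1 // => c.
    by rewrite eq_sym => /negbTE ->.
  rewrite -sum_nat_const leq_sum // => c _; apply: ltnW.
  by rewrite ltnNge nc.
set F := filter (fun xc => xc.2 == c) P.
have mF : mono k.+1 chi (map fst F).
  by apply: (prehom_mono (c := c)); [exact: prehom_filter | exact: filter_all].
have sF : subseq (take n (map fst F)) (map fst F) by exact: take_subseq.
exists (take n (map fst F)); split; last exact: mono_sub mF.
  apply: subseq_trans sF _; apply: subseq_trans sP.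
  by apply: map_subseq; exact: filter_subseq.
by rewrite size_takel // size_map size_filter.
Qed.

Lemma ramsey_upto (C : finType) (D : nat) : forall n, exists N,
  forall (T : eqType) (chi : nat -> seq T -> C) (L : seq T), (N <= size L)%N ->
  exists L', [/\ subseq L' L, size L' = n &
    forall k, (k <= D)%N -> mono k (chi k) L'].
Proof.
elim: D => [|D IH] n.
  have [N HN] := ramsey C 0 n; exists N => T chi L /(HN _ (chi 0)) [L' [s z m]].
  by exists L'; split=> // k; rewrite leqn0 => /eqP ->.
have [M HM] := ramsey C D.+1 n; have [N HN] := IH M.
exists N => T chi L /(HN _ chi) [L1 [s1 z1 m1]].
have [|L2 [s2 z2 m2]] := HM _ (chi D.+1) L1; first by rewrite z1.
exists L2; split=> //; first exact: subseq_trans s1.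
move=> k; rewrite leq_eqVlt => /orP [/eqP -> //|]; rewrite ltnS => /m1.
exact: mono_sub.
Qed.

Lemma increasing_nth_subseq (m k : nat) (L : seq nat) (t : 'I_k -> 'I_m) :
  sorted ltn L -> size L = m -> increasing t ->
  subseq [seq nth 0%N L (t i) | i <- enum 'I_k] L.
Proof.
move=> sL zL it; set u := map _ _.
have su : sorted ltn u.
  rewrite /u sorted_map; apply: (sub_sorted (e := relpre val ltn)).
    move=> a b /= /it ab.
    by apply: (sorted_ltn_nth ltn_trans) => //; rewrite inE zL.
  by rewrite -sorted_map val_enum_ord iota_ltn_sorted.
suff -> : u = filter (mem u) L by exact: filter_subseq.
apply: (irr_sorted_eq ltn_trans ltnn) => //.
  exact: (sorted_filter ltn_trans).
move=> x; rewrite mem_filter /=; case xu: (x \in u) => //=; apply/esym.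
by move: xu => /mapP [i _ ->]; rewrite mem_nth // zL.
Qed.

Lemma increasing_enum_image (m k : nat) (f : 'I_k -> 'I_m) :
  injective f -> exists (t : 'I_k -> 'I_m) (h : 'I_k -> 'I_k),
    increasing t /\ f =1 t \o h.
Proof.
move=> injf; set A := [set f i | i in 'I_k].
have cA : #|A| = k by rewrite card_imset // card_ord.
have fA i : f i \in A by apply: imset_f.
exists (fun i => enum_val (cast_ord (esym cA) i)).
exists (fun i => cast_ord cA (enum_rank_in (fA i) (f i))); split; last first.
  by move=> i; rewrite /= cast_ordK enum_rankK_in.
have szA : size (enum A) = k by rewrite -cardE.
move=> a b ab.
rewrite /enum_val (set_nth_default (f a) (enum_default (cast_ord (esym cA) b)))
  ?szA //=.
rewrite (set_nth_default (f a) (enum_default (cast_ord (esym cA) a)))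
  ?szA //=.
have sA : sorted (relpre val ltn) (enum A).
  rewrite {1}/enum_mem; apply: sorted_filter.
    by move=> x y z; apply: ltn_trans.
  by rewrite -enumT -sorted_map val_enum_ord iota_ltn_sorted.
have trA : transitive (relpre (@nat_of_ord m) ltn) by move=> x y z; apply: ltn_trans.
by apply: (sorted_ltn_nth trA) => //; rewrite inE szA.
Qed.

Lemma degenerate_hyperplane (R : realType) (j m : nat) (q : 'I_m -> 'rV[R]_j) :
  (0 < m)%N ->
  (forall t : 'I_j.+1 -> 'I_m, increasing t ->
     \det (homog_matrix (fun a => q (t a))) = 0) ->
  exists (a : 'rV[R]_j) (b : R), a != 0 /\ forall i, on_hyperplane a b (q i).
Proof.
move=> m0 H; set A := homog_matrix q.
have : ~~ row_full A^T.
  apply/negP => fA; have /increasing_enum_image [t [h [it fh]]] := fullrankfun_inj (rkA := fA).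
  have : row_full (rowsub t A^T).
    rewrite -sub1mx; apply: submx_trans (submx_rowsub h fh).
    by rewrite sub1mx fullrowsub_full.
  rewrite row_full_unit unitmxE -det_tr.
  suff -> : (rowsub t A^T)^T = homog_matrix (fun a => q (t a)) by rewrite H // unitr0.
  by apply/matrixP => r c; rewrite !mxE.
rewrite -[row_full _]/(\rank _ == _) mxrank_tr -[\rank _ == _]/(row_free A).
rewrite -kermx_eq0 => /rowV0Pn [u /sub_kermxP uA u0].
have E i : u 0 ord0 + \sum_k u 0 (lift ord0 k) * q i 0 k = 0.
  have := congr1 (fun M : 'rV_m => M 0 i) uA.
  rewrite !mxE big_ord_recl !mxE unlift_none mulr1 => uA0; rewrite -[RHS]uA0; congr (_ + _).
  by apply: eq_bigr => k _; rewrite !mxE liftK.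
exists (\row_k u 0 (lift ord0 k)), (- u 0 ord0); split; last first.
  move=> i; rewrite /on_hyperplane; under eq_bigr do rewrite mxE.
  by apply/eqP; rewrite -addr_eq0 addrC E.
apply: contra_neq u0 => u'0; apply/rowP => k; rewrite mxE.
have u'k l : u 0 (lift ord0 l) = 0.
  by have := congr1 (fun M : 'rV_j => M 0 l) u'0; rewrite !mxE.
case: (unliftP ord0 k) => [l ->|->]; first exact: u'k.
have := E (Ordinal m0); rewrite big1 ?addr0 // => l _.
by rewrite u'k mul0r.
Qed.

Lemma hyperplane_lift (R : realType) (d j : nat) (hj : (j <= d)%N)
    (a : 'rV[R]_j) (b : R) : a != 0 ->
  exists a' : 'rV[R]_d, a' != 0 /\
    forall x, on_hyperplane a b (proj hj x) -> on_hyperplane a' b x.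
Proof.
move=> a0; exists (\row_k if insub (val k) is Some l then a 0 l else 0).
have wE l : insub (val (widen_ord hj l)) = Some l :> option 'I_j by rewrite /= valK.
split.
  apply: contra_neq a0 => H; apply/rowP => l; rewrite mxE.
  have := congr1 (fun M : 'rV_d => M 0 (widen_ord hj l)) H.
  by rewrite !mxE wE.
move=> x <-; rewrite /on_hyperplane (bigID (fun k : 'I_d => (k < j)%N)) /=.
rewrite (big_ord_narrow hj) [X in _ + X]big1 ?addr0; last first.
  by move=> k /negbTE kj; rewrite mxE insubF // mul0r.
by apply: eq_bigr => l _; rewrite !mxE wE.
Qed.

Lemma ot_homogeneous_sub (R : realType) (j m n : nat) (q : 'I_n -> 'rV[R]_j)
    (s : 'I_m -> 'I_n) :
  increasing s -> ot_homogeneous q -> ot_homogeneous (fun i => q (s i)).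
Proof.
move=> si [c [c0 Hc]]; exists c; split=> // t ti.
by apply: (Hc (fun a => s (t a))) => a b /ti /si.
Qed.

Lemma forces_super_ot_exists (R : realType) (d n : nat) :
  exists N, `[< forces_super_ot R d n N >].
Proof.
pose m := maxn n d.+1; have [N HN] := ramsey_upto (bool * bool)%type d.+1 m.
exists N; apply/asboolP => p gp.
pose pn i := if insub i is Some i' then p i' else 0.
pose col (x : R) := (0 < x, x < 0).
pose qt j (t : seq nat) (a : 'I_j.+1) : 'rV[R]_j := \row_(k < j)
  if insub (val k) is Some l then pn (nth 0%N t a) 0 (l : 'I_d) else 0.
pose chi k t :=
  if k is j.+1 then col (\det (homog_matrix (qt j t))) else (true, true).
have [|L [sL zL mL]] := HN _ chi (iota 0 N); first by rewrite size_iota.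
have ltL : sorted ltn L := subseq_sorted ltn_trans sL (iota_ltn_sorted 0 N).
have LN (i : 'I_m) : (nth 0%N L i < N)%N.
  have : nth 0%N L i \in L by rewrite mem_nth // zL.
  by move/(mem_subseq sL); rewrite mem_iota.
pose s i := Ordinal (LN i).
have si : increasing s.
  by move=> a b ab; apply: (sorted_ltn_nth ltn_trans) => //; rewrite inE zL.
have sinj : injective s.
  move=> a b sab; apply/val_inj; case: (ltngtP a b) => // /si; by rewrite sab ltnn.
pose w (i : 'I_n) : 'I_m := widen_ord (leq_maxl n d.+1) i.
exists (fun i => s (w i)); split; first by move=> a b ab; apply: si.
move=> j hj j1; apply: (ot_homogeneous_sub (s := w)
  (q := fun i => proj hj (p (s i)))) => //.
have [c Hc] := mL j.+1 hj.
have cE (t : 'I_j.+1 -> 'I_m) : increasing t ->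
    col (\det (homog_matrix (fun a => proj hj (p (s (t a)))))) = c.
  move=> it; rewrite -(Hc _ (increasing_nth_subseq ltL zL it)); last first.
    by rewrite size_map size_enum_ord.
  rewrite /chi; congr (col (\det _)); apply/matrixP => r b; rewrite !mxE.
  case: (unlift _ _) => // k; rewrite !mxE.
  rewrite (insubT (fun x => x < d)%N (leq_trans (ltn_ord k) hj)).
  rewrite (nth_map b) ?size_enum_ord // nth_ord_enum /pn.
  rewrite (insubT (fun x => x < N)%N (LN (t b))); congr (p _ _ _).
  exact: val_inj.
case: c Hc cE => [[] cn] Hc cE.
  exists 1; split; first exact: oner_neq0.
  by move=> t /cE [/gtr0_sg].
case: cn Hc cE => Hc cE.
  exists (-1); split; first by rewrite oppr_eq0 oner_neq0.
  by move=> t /cE [_ /ltr0_sg].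
have [|t it|a [b [a0 Hab]]] := @degenerate_hyperplane R j m
    (fun i => proj hj (p (s i))).
- by rewrite leq_max orbT.
- by case: (cE t it) => h1 h2; apply/eqP; rewrite eq_le !leNgt h1 h2.
have [a' [a'0 Ha']] := hyperplane_lift hj b a0.
pose v (i : 'I_d.+1) : 'I_m := widen_ord (leq_maxr n d.+1) i.
case: (gp [set s (v i) | i in 'I_d.+1]).
  rewrite card_imset ?card_ord // => x y /sinj /(congr1 val) /= xy.
  exact: val_inj.
exists a', b; split=> // i /imsetP [k _ ->]; apply: Ha'; exact: Hab.
Qed.

Definition OTstar (R : realType) (d n : nat) : nat :=
  ex_minn (forces_super_ot_exists R d n).

(* Indexed from 1: [twr 1 x = x] and [twr i.+1 x = 2 ^ twr i x] for [1 <= i]; *)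
(* the value at [i = 0] is irrelevant.                                        *)
Definition twr (i x : nat) : nat := iter i.-1 (expn 2) x.

(* Main.v *)
Require Import Defs.
From mathcomp Require Import all_boot all_order all_algebra all_fingroup.
From mathcomp Require Import polyrcf zify.
From mathcomp Require Import boolp reals.

Set Implicit Arguments.
Unset Strict Implicit.
Unset Printing Implicit Defensive.

Import Order.TTheory GRing.Theory Num.Theory.
Local Open Scope ring_scope.

(** The proof steps up from dimension d to d + 1. From points p_0, ..., p_(N-1)
    in R^d one builds, for x < 2^N with binary digits x_i, the points
      q_x = sum_i x_i T^(i+1) (1, p_i) + (x, x^2, ..., x^(d+1)),  T large.
    The orientation of j + 2 of these points, projected to R^(j+1), is the
    determinant of the consecutive differences, a polynomial in T. At T = 0 it
    is a Vandermonde determinant, so it is nonzero for large T. The difference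
    of x < y is dominated by T^(i+1) (1, p_i), where i is the top digit in which
    they differ, so the top coefficient is the orientation of the corresponding
    p_i's, projected to R^j. When the first coordinates of the p_i increase,
    homogeneity in the plane makes these top digits monotone along a homogeneous
    sequence of n + 1 points q_x, and the n corresponding points p_i then form a
    homogeneous sequence. Starting from n - 1 points on the line and iterating
    gives twr_d(n - d) points without a homogeneous subsequence of length n. *)

(** * Top coefficients of determinants, and orientation minors *)

Section Determinants.
Variable K : comNzRingType.

Lemma coefM_top (p q : {poly K}) m n :
  (size p <= m.+1)%N -> (size q <= n.+1)%N ->
  (p * q)`_(m + n) = p`_m * q`_n.
Proof.
move=> sp sq; rewrite coefM.
have mn : (m < (m + n).+1)%N by lia.
rewrite (bigD1 (Ordinal mn)) //= addKn big1 ?addr0 // => i; rewrite -val_eqE /= => im.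
have [lt_im|le_mi] := ltnP i m; first by rewrite (nth_default _ (s := q)) ?mulr0 //; lia.
rewrite (nth_default _ (s := p)) ?mul0r //; apply: leq_trans sp _.
by rewrite ltn_neqAle eq_sym im.
Qed.

Lemma coef_prod_top (I : Type) (r : seq I) (f : I -> {poly K}) (k : I -> nat) :
  (forall i, size (f i) <= (k i).+1)%N ->
  (size (\prod_(i <- r) f i)%R <= (\sum_(i <- r) k i).+1)%N /\
  (\prod_(i <- r) f i)`_(\sum_(i <- r) k i)%N = \prod_(i <- r) (f i)`_(k i).
Proof.
move=> fk; elim: r => [|i r [sz co]]; first by rewrite !big_nil size_poly1 coef1 eqxx.
rewrite !big_cons; split; last by rewrite coefM_top ?co.
apply: leq_trans (size_polyMleq _ _) _; have := fk i; lia.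
Qed.

(** Each Leibniz term takes one entry from every row, so the row bounds add up and the coefficient
    at their sum is the product of the entries' coefficients at the row bounds. *)
Lemma det_coef_top n (W : 'M[{poly K}]_n) (k : 'I_n -> nat) :
  (forall r c, size (W r c) <= (k r).+1)%N ->
  (size (\det W) <= (\sum_r k r).+1)%N /\
  (\det W)`_(\sum_r k r)%N = \det (\matrix_(r, c) (W r c)`_(k r)).
Proof.
move=> Wk; split.
  apply: leq_trans (size_sum _ _ _) _; apply/bigmax_leqP => s _.
  rewrite mulr_sign (fun_if (fun p : {poly K} => size p)) size_polyN if_same.
  by have [] := coef_prod_top (index_enum 'I_n) (fun i => Wk i (s i)).
rewrite /determinant coef_sum; apply: eq_bigr => s _.
rewrite !mulr_sign; have [_ co] := coef_prod_top (index_enum 'I_n) (fun i => Wk i (s i)).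
under [X in _ = if _ then - X else X]eq_bigr do rewrite mxE.
by case: ifP => _; rewrite ?coefN co.
Qed.

(* In [a x r] the index [x] numbers the points, [a x 0 = 1], and [a x r.+1] is
   the [r]-th coordinate, so [minor a j t] is the orientation determinant of the
   projections to the first [j] coordinates of the points [t 0, ..., t j]. *)
Definition minor (a : nat -> nat -> K) (j : nat) (t : nat -> nat) : K :=
  \det (\matrix_(r < j.+1, c < j.+1) a (t c) r).

Lemma eq_minor a j t u :
  (forall c, c <= j -> t c = u c)%N -> minor a j t = minor a j u.
Proof.
by move=> tu; congr (\det _); apply/matrixP => r c; rewrite !mxE tu // -ltnS.
Qed.

Lemma minor0 a t : (forall x, a x 0%N = 1) -> minor a 0 t = 1.
Proof. by move=> a0; rewrite /minor det_mx11 mxE a0. Qed.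

Lemma minorS a j t : (forall x, a x 0%N = 1) ->
  minor a j.+1 t =
  \det (\matrix_(r < j.+1, c < j.+1) (a (t c.+1) r.+1 - a (t c) r.+1)).
Proof.
move=> a0.
(* Right multiplication by [D] replaces each column but the first by its
   difference with the preceding one. *)
pose D : 'M[K]_j.+2 := \matrix_(k, c) ((k == c)%:R - (k.+1 == c :> nat)%:R).
have dD : \det D = 1.
  rewrite -det_tr det_trig; last first.
    apply/is_trig_mxP => c k ck; rewrite !mxE -val_eqE /=.
    by rewrite !gtn_eqF ?subrr // ltnW.
  by rewrite big1 // => i _; rewrite !mxE eqxx gtn_eqF ?subr0.
rewrite /minor -[LHS]mulr1 -dD -det_mulmx (expand_det_row _ ord0).
set M := _ *m _.
have M0 r : M r ord0 = a (t 0%N) r.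
  rewrite mxE (bigD1 ord0) //= !mxE eqxx subr0 mulr1 big1 ?addr0 // => k /negbTE k0.
  by rewrite !mxE k0 subrr mulr0.
have MS r (c : 'I_j.+1) : M r (lift ord0 c) = a (t c.+1) r - a (t c) r.
  rewrite mxE; under eq_bigr do rewrite !mxE mulrBr.
  rewrite sumrB (bigD1 (lift ord0 c)) //= eqxx mulr1 big1 ?addr0; last first.
    by move=> k /negbTE ->; rewrite mulr0.
  rewrite (bigD1 (widen_ord (leqnSn _) c)) //= eqxx mulr1 big1 ?addr0 //.
  by move=> k; rewrite -val_eqE /= /bump /= add1n eqSS => /negbTE ->; rewrite mulr0.
rewrite big_ord_recl M0 a0 mul1r big1 ?addr0; last first.
  by move=> c _; rewrite MS !a0 subrr mul0r.
rewrite /cofactor expr0 mul1r; congr (\det _); apply/matrixP => r c.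
by rewrite [LHS]mxE [LHS]mxE MS !mxE.
Qed.

Lemma minor1 a t : (forall x, a x 0%N = 1) ->
  minor a 1 t = a (t 1%N) 1%N - a (t 0%N) 1%N.
Proof. by move=> a0; rewrite minorS // det_mx11 mxE. Qed.

Lemma minor_rev a j t :
  minor a j (fun c => t (j - c)%N) = (-1) ^+ perm (@rev_ord_inj j.+1) * minor a j t.
Proof.
rewrite /minor; set M := (X in _ = _ * \det X).
rewrite -[X in X ^+ _ * _]/(-1 : K) -det_perm mulrC -det_mulmx -[perm _]invgK -col_permE.
congr (\det _); apply/matrixP => r c; rewrite !mxE; congr (a (t _) _).
have -> : ((perm (@rev_ord_inj j.+1))^-1)%g c = rev_ord c.
  by apply: (perm_inj (s := perm (@rev_ord_inj j.+1))); rewrite permKV permE rev_ordK.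
by rewrite /= subSS.
Qed.

End Determinants.

Lemma minor_expr_neq0 (K : numDomainType) j (t : nat -> nat) :
  (forall b c, b < c <= j -> t b < t c)%N ->
  minor (fun x r => (x%:R : K) ^+ r) j t != 0.
Proof.
move=> ti; rewrite (_ : minor _ _ _ = \det (Vandermonde j.+1 (\row_c (t c)%:R))).
  rewrite det_Vandermonde; apply/prodf_neq0 => b _; apply/prodf_neq0 => c bc.
  rewrite !mxE subr_eq0 eqr_nat gtn_eqF // ti //.
  by rewrite bc -ltnS ltn_ord.
by congr (\det _); apply/matrixP => r c; rewrite !mxE.
Qed.

(** * Signs of polynomials at large arguments *)

Lemma sgr_horner_pinfty (R : realFieldType) (p : {poly R}) :
  p != 0 -> exists T0, forall T, T0 <= T -> Num.sg p.[T] = Num.sg (lead_coef p).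
Proof.
rewrite -lead_coef_eq0 => p0.
have [lp|lp] : 0 < lead_coef p \/ 0 < lead_coef (- p).
  by rewrite lead_coefN oppr_gt0; case: (ltgtP (lead_coef p) 0) p0; auto.
  have [T0 H] := poly_pinfty_gt_lc lp; exists T0 => T /H h.
  by rewrite !gtr0_sg // (lt_le_trans lp).
have [T0 H] := poly_pinfty_gt_lc lp; exists T0 => T /H h.
rewrite -[p]opprK hornerN lead_coefN !sgrN; congr (- _).
by rewrite !gtr0_sg // (lt_le_trans lp).
Qed.

Lemma eventually_forall (R : realDomainType) (I : finType) (P : I -> R -> Prop) :
  (forall i, exists T0, forall T, T0 <= T -> P i T) ->
  exists T0, forall T, T0 <= T -> forall i, P i T.
Proof.
move=> /choice [f Hf]; exists (\big[Num.max/0]_i f i) => T fT i.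
by apply/Hf/le_trans/fT/le_bigmax.
Qed.

Local Open Scope nat_scope.

(** * Binary digits *)

Lemma level_exists x y : exists k, x %/ 2 ^ k == y %/ 2 ^ k.
Proof.
exists (x + y); rewrite !divn_small //.
  by apply: leq_ltn_trans (ltn_expl _ _); rewrite ?leq_addl.
by apply: leq_ltn_trans (ltn_expl _ _); rewrite ?leq_addr.
Qed.

(* One more than the index of the top binary digit in which [x] and [y] differ. *)
Definition level x y := ex_minn (level_exists x y).

Lemma level_leP x y k : (level x y <= k) = (x %/ 2 ^ k == y %/ 2 ^ k).
Proof.
rewrite /level; case: ex_minnP => m /eqP xy mmin.
apply/idP/idP => [mk|/mmin //].
by rewrite -(subnKC mk) expnD !divnMA xy.
Qed.

Lemma level_gt0 x y : x < y -> 0 < level x y.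
Proof. by move=> xy; rewrite ltnNge level_leP !divn1 ltn_eqF. Qed.

Lemma level_le_bound x y N : x < 2 ^ N -> y < 2 ^ N -> level x y <= N.
Proof. by move=> xN yN; rewrite level_leP !divn_small. Qed.

(** Numbers with equal quotient by [2 ^ k] form an interval, so [x] and [z] share a block exactly
    when [y] shares it with both. *)
Lemma level_max x y z : x <= y <= z -> level x z = maxn (level x y) (level y z).
Proof.
case/andP=> xy yz; apply/eqP; rewrite eqn_leq geq_max !level_leP.
set k := maxn _ _.
have /eqP -> : x %/ 2 ^ k == y %/ 2 ^ k by rewrite -level_leP leq_maxl.
rewrite -level_leP leq_maxr /=; set l := level x z.
have /eqP e : x %/ 2 ^ l == z %/ 2 ^ l by rewrite -level_leP.
have := leq_div2r (2 ^ l) xy; have := leq_div2r (2 ^ l) yz; rewrite e.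
move=> h1 h2; have -> : y %/ 2 ^ l = z %/ 2 ^ l by apply/anti_leq/andP.
by rewrite eqxx.
Qed.

Lemma level_bits x y i : x < y -> level x y = i.+1 ->
  [/\ ~~ odd (x %/ 2 ^ i), odd (y %/ 2 ^ i)
    & forall k, i < k -> x %/ 2 ^ k = y %/ 2 ^ k].
Proof.
move=> xy lxy.
have h k : i < k -> x %/ 2 ^ k = y %/ 2 ^ k.
  by move=> ik; apply/eqP; rewrite -level_leP lxy.
have := h _ (ltnSn i); rewrite expnSr !divnMA !divn2 => e.
have : x %/ 2 ^ i != y %/ 2 ^ i by rewrite -level_leP lxy ltnn.
have := leq_div2r (2 ^ i) (ltnW xy).
have := odd_double_half (x %/ 2 ^ i); have := odd_double_half (y %/ 2 ^ i).
rewrite e; case: (odd (x %/ _)); case: (odd (y %/ _)) => /=; split=> //; lia.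
Qed.

(** At a common top differing digit, [y] would have digit 1 because [x < y] and digit 0 because
    [y < z]. *)
Lemma level_neq x y z : x < y < z -> level x y != level y z.
Proof.
case/andP=> xy yz; apply/eqP => e.
have := level_gt0 xy; case exy: (level x y) => [//|i] _.
have [_ o _] := level_bits xy exy.
by rewrite exy in e; have [] := level_bits yz (esym e); rewrite o.
Qed.

Definition incr n (t : nat -> nat) := forall b c, b < c < n -> t b < t c.

Lemma incrP n t : (forall i, i.+1 < n -> t i < t i.+1) -> incr n t.
Proof.
move=> ti b c; elim: c => [|c IH] // /andP[]; rewrite ltnS leq_eqVlt.
case/orP=> [/eqP -> /ti //|bc cn]; apply: ltn_trans (ti _ cn).
by apply: IH; rewrite bc ltnW.
Qed.

Lemma incr_le n t b c : incr n t -> b <= c < n -> t b <= t c.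
Proof.
by move=> ti; rewrite leq_eqVlt => /andP[/orP[/eqP ->//|bc] cn]; rewrite ltnW // ti ?bc.
Qed.

(** The index of the top differing digit. Where [t] increases, [level] is positive and [.-1] does
    not truncate. *)
Definition delta (t : nat -> nat) c := (level (t c) (t c.+1)).-1.

Lemma level_delta n t c : incr n.+1 t -> c < n -> level (t c) (t c.+1) = (delta t c).+1.
Proof. by move=> ti cn; rewrite /delta prednK // level_gt0 // ti // ltnSn. Qed.

Lemma delta_lt N n t c : incr n.+1 t -> t n < 2 ^ N -> c < n -> delta t c < N.
Proof.
move=> ti tN cn; rewrite -(level_delta ti cn) level_le_bound //.
  by apply: leq_ltn_trans tN; apply: incr_le ti _; rewrite ltnW /=.
by apply: leq_ltn_trans tN; apply: incr_le ti _; rewrite cn /=.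
Qed.

Lemma delta_neq n t c : incr n.+1 t -> c.+1 < n -> delta t c != delta t c.+1.
Proof.
move=> ti cn; rewrite -eqSS -!(level_delta ti) ?(ltnW cn) // level_neq //.
by rewrite !ti // ltnSn /= ?ltnS // ltnW.
Qed.

(** By [level_max] the level is the largest one over the consecutive pairs in between. The last pair
    attains it, so only [c] matters. *)
Lemma level_incr n t b c : incr n.+1 t -> incr n (delta t) -> b <= c < n ->
  level (t b) (t c.+1) = (delta t c).+1.
Proof.
move=> ti di /andP[bc cn]; elim: c bc cn => [|c IH].
  by rewrite leqn0 => /eqP -> cn; rewrite (level_delta ti).
rewrite leq_eqVlt => /orP[/eqP -> cn|bc cn]; first by rewrite (level_delta ti).
rewrite (@level_max _ (t c.+1)); last first.
  by apply/andP; split; apply: (incr_le ti); lia.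
rewrite IH ?(ltnW cn) // (level_delta ti) //; apply/maxn_idPr.
by rewrite ltnS ltnW // di // ltnSn.
Qed.

(** Now the first pair attains the maximum, so only [b] matters. *)
Lemma level_decr n t b c : incr n.+1 t ->
  (forall i, i.+1 < n -> delta t i.+1 < delta t i) -> b < c <= n ->
  level (t b) (t c) = (delta t b).+1.
Proof.
move=> ti dd /andP[bc cn].
suff [//] : level (t b) (t c) = (delta t b).+1 /\ delta t c.-1 <= delta t b.
elim: c bc cn => [//|c IH].
rewrite ltnS leq_eqVlt => /orP[/eqP -> cn|bc cn]; first by rewrite (level_delta ti).
have [|e le] := IH bc; first exact: ltnW.
have lt : delta t c <= delta t b.
  by apply: leq_trans le; case: c {IH e} bc cn => // c bc cn; rewrite ltnW // dd.
split=> //; rewrite (@level_max _ (t c)); last first.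
  by apply/andP; split; apply: (incr_le ti); lia.
by rewrite e (level_delta ti) //; apply/maxn_idPl.
Qed.

Local Open Scope ring_scope.

(** * Stepping up *)

Section StepUp.
Variables (R : realType) (a : nat -> nat -> R) (N : nat).

Definition stepup_poly x r : {poly R} :=
  if r is r'.+1 then
    \poly_(m < N.+1)
      (if m is i.+1 then (odd (x %/ 2 ^ i))%:R * a i r' else x%:R ^+ r)
  else 1.

Definition stepup T x r : R := (stepup_poly x r).[T].

Lemma minor_stepup T j t : minor (stepup T) j t = (minor stepup_poly j t).[T].
Proof.
rewrite -horner_evalE -det_map_mx; congr (\det _); apply/matrixP => r c.
by rewrite !mxE.
Qed.

Lemma minor_stepup_poly_neq0 j t : incr j.+1 t -> minor stepup_poly j t != 0.
Proof.
move=> ti; apply: contra_neq (@minor_expr_neq0 R j t ti) => e.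
rewrite -[RHS](horner0 0) -e -minor_stepup; congr (\det _).
apply/matrixP => r c; rewrite !mxE /stepup.
by case: (r : nat) => [|k] /=; rewrite ?hornerC ?expr0 // horner_coef0 coef_poly.
Qed.

Lemma minor_stepup_poly_top j t : incr j.+2 t -> (t j.+1 < 2 ^ N)%N ->
  let k := (\sum_(c < j.+1) (delta t c).+1)%N in
  (size (minor stepup_poly j.+1 t) <= k.+1)%N /\
  (minor stepup_poly j.+1 t)`_k = minor a j (delta t).
Proof.
move=> ti tN; rewrite minorS // -det_tr; set W := (_^T).
have lt_c (c : 'I_j.+1) : (t c < t c.+1)%N by rewrite ti // ltnSn !ltnS -ltnS ltn_ord.
(* Digit [delta t c] is 0 in [t c] and 1 in [t c.+1], so one copy of [a (delta t c)] survives in the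
   difference. *)
have cW (c r : 'I_j.+1) : (W c r)`_(delta t c).+1 = a (delta t c) r.
  have [ox oy _] := level_bits (lt_c c) (level_delta ti (ltn_ord c)).
  rewrite !mxE coefB !coef_poly ltnS (delta_lt ti tN (ltn_ord c)).
  by rewrite oy (negbTE ox) mul1r mul0r subr0.
have sW (c r : 'I_j.+1) : (size (W c r) <= (delta t c).+2)%N.
  have [_ _ h] := level_bits (lt_c c) (level_delta ti (ltn_ord c)).
  apply/leq_sizeP => -[//|m] cm; rewrite !mxE coefB !coef_poly h //.
  by case: ifP; rewrite subrr.
have [sz co] := det_coef_top sW; split=> //; rewrite co -[RHS]det_tr.
by congr (\det _); apply/matrixP => c r; rewrite [LHS]mxE cW !mxE.
Qed.

Lemma stepup_eventually d : exists T, forall j t, (j <= d)%N ->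
  incr j.+2 t -> (t j.+1 < 2 ^ N)%N ->
  minor (stepup T) j.+1 t != 0 /\
  (minor a j (delta t) != 0 ->
     Num.sg (minor (stepup T) j.+1 t) = Num.sg (minor a j (delta t))).
Proof.
pose P j t T := minor (stepup T) j.+1 t != 0 /\ (minor a j (delta t) != 0 ->
  Num.sg (minor (stepup T) j.+1 t) = Num.sg (minor a j (delta t))).
have evP j t : incr j.+2 t -> (t j.+1 < 2 ^ N)%N ->
    exists T0, forall T, T0 <= T -> P j t T.
  move=> ti tN; have p0 := minor_stepup_poly_neq0 ti.
  have [T0 HT0] := sgr_horner_pinfty p0; exists T0 => T /HT0 sT.
  rewrite /P minor_stepup; split; first by rewrite -sgr_eq0 sT sgr_eq0 lead_coef_eq0.
  have [sz co] := minor_stepup_poly_top ti tN; rewrite sT -co => c0.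
  rewrite lead_coefE; congr (Num.sg _`__); apply/eqP.
  rewrite -eqSS prednK ?size_poly_gt0 // eqn_leq sz ltnNge.
  by apply: contraNN c0 => /(nth_default 0) ->.
(* Tuples below [2 ^ N] are coded by finite functions, so that one threshold serves all of them. *)
pose ext j (g : {ffun 'I_j.+2 -> 'I_(2 ^ N)}) c : nat := g (inord c).
have [T0 HT0] : exists T0, forall T, T0 <= T -> forall (j : 'I_d.+1) g,
    incr j.+2 (ext j g) -> P j (ext j g) T.
  apply: eventually_forall => j; apply: eventually_forall => g.
  have [gi|ngi] := pselect (incr j.+2 (ext j g)); last by exists 0.
  by have [T0 H] := evP _ _ gi (ltn_ord _); exists T0 => T /H.
exists T0 => j t jd ti tN.
have t2 c : (c <= j.+1)%N -> (t c < 2 ^ N)%N.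
  by move=> cj; apply: leq_ltn_trans tN; apply: (incr_le ti); rewrite cj /=.
pose g := [ffun c : 'I_j.+2 => Ordinal (t2 c (ltn_ord c))].
have tE c : (c <= j.+1)%N -> ext j g c = t c by move=> cj; rewrite /ext ffunE /= inordK.
have gi : incr j.+2 (ext j g).
  by move=> b c /andP[bc cj]; rewrite !tE ?ti ?bc //; lia.
have := HT0 T0 (lexx _) (Ordinal (jd : (j < d.+1)%N)) g gi.
rewrite /P /= (eq_minor _ tE) (@eq_minor _ _ _ (delta _) (delta t)) //.
by move=> c cj; rewrite /delta !tE //; lia.
Qed.

End StepUp.

(** * Configurations without long homogeneous subsequences *)

Section Bad.
Variable R : realType.
Implicit Type a : nat -> nat -> R.

Definition homog a j n (s : nat -> nat) := exists2 e : R, e != 0 &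
  forall t, incr j.+1 t -> (t j < n)%N -> Num.sg (minor a j (s \o t)) = e.

(** The invariant of the induction. [bad_first] allows planar signs to be read as comparisons of top
    differing digits. *)
Record bad a d n N : Prop := Bad {
  bad_one : forall x, a x 0%N = 1;
  bad_gp : forall j t, (j <= d)%N -> incr j.+1 t -> (t j < N)%N -> minor a j t != 0;
  bad_first : forall x y, (x < y < N)%N -> a x 1%N < a y 1%N;
  bad_free : forall s, incr n s -> (s n.-1 < N)%N ->
    ~ (forall j, (1 <= j <= d)%N -> homog a j n s) }.

Lemma bad_base n : (0 < n)%N -> bad (fun x r => x%:R ^+ r) 1 n n.-1.
Proof.
move=> n0; split=> [x|j t _ ti _|x y /andP[xy _]|s si sn _].
- by rewrite expr0.
- exact: minor_expr_neq0.
- by rewrite !expr1 ltr_nat.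
- have ge k : (k < n -> k <= s k)%N.
    elim: k => // k IH kn; apply: leq_ltn_trans (IH (ltnW kn)) _.
    by rewrite si // ltnSn.
  by have := ge n.-1; lia.
Qed.

Lemma bad_step a d n N : (0 < d)%N -> (0 < n)%N -> bad a d n N ->
  exists a', bad a' d.+1 n.+1 (2 ^ N).
Proof.
move=> d0 n0 [a0 gp fst free].
have [T HT] := stepup_eventually a N d; set a' := stepup a N T in HT.
have a'0 x : a' x 0%N = 1 by rewrite /a' /stepup /= hornerC.
exists a'; split=> // [[|j] t jd ti tN|x y /andP[xy yN]|s si sN hs].
- by rewrite minor0 // oner_neq0.
- by have [] := HT j t jd ti tN.
(* The case [j = 0]: [minor a 0] is 1, so the difference of first coordinates is positive. *)
- pose t c := if c is 0%N then x else y.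
  have [|//|_] := HT 0%N t (leq0n d); first by apply: incrP => -[].
  rewrite minor1 // minor0 // oner_neq0 => /(_ isT).
  by rewrite sgr1 => /eqP; rewrite sgr_cp0 subr_gt0.
have {}sN : (s n < 2 ^ N)%N := sN.
pose del := delta s.
have dN i : (i < n)%N -> (del i < N)%N by exact: delta_lt.
have sgE j t : (j <= d)%N -> incr j.+2 t -> (t j.+1 <= n)%N ->
    minor a j (delta (s \o t)) != 0 ->
    Num.sg (minor a' j.+1 (s \o t)) = Num.sg (minor a j (delta (s \o t))).
  move=> jd ti tn; apply: (HT j _ jd _ _).2.
    move=> b c /andP[bc cj]; apply: si; rewrite ti ?bc // ltnS.
    by apply: leq_trans tn; apply: (incr_le ti); rewrite ltnSn -ltnS cj.
  by apply: leq_ltn_trans sN; apply: (incr_le si); rewrite tn ltnSn.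
have [e2 e20 He2] : homog a' 2 n.+1 s by apply: hs; rewrite /= ltnS.
(* Consecutive triples all have sign [e2], which is thus the sign of every step of the first
   coordinate along [del]. *)
have sgdel i : (i.+1 < n)%N -> Num.sg (a (del i.+1) 1%N - a (del i) 1%N) = e2.
  move=> ilt; have dneq := delta_neq si ilt.
  pose t c := (i + c)%N; have ti k : incr k t by move=> b c; rewrite /t; lia.
  have dE : minor a 1 (delta (s \o t)) = a (del i.+1) 1%N - a (del i) 1%N.
    by rewrite minor1 // /delta /= /t addn0 !addnS addn0.
  rewrite -(He2 t) ?sgE ?dE //; try by rewrite /t; lia.
  have di := dN _ (ltnW ilt); have di1 := dN _ ilt.
  have [lt|gt|/eqP eq] := ltngtP (del i) (del i.+1).
  - by rewrite subr_eq0 gt_eqF // fst // lt.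
  - by rewrite subr_eq0 lt_eqF // fst // gt.
  - by rewrite -/(del i) -/(del i.+1) eq in dneq.
have dlt i : (i.+1 < n)%N -> 0 < e2 -> (del i < del i.+1)%N.
  move=> ilt; rewrite -(sgdel i ilt) sgr_gt0 subr_gt0 => lt.
  case: (ltngtP (del i) (del i.+1)) lt => // [gt|->]; rewrite ?ltxx //.
  by rewrite ltNge ltW // fst // gt dN // ltnW.
have dgt i : (i.+1 < n)%N -> e2 < 0 -> (del i.+1 < del i)%N.
  move=> ilt; rewrite -(sgdel i ilt) sgr_lt0 subr_lt0 => lt.
  case: (ltngtP (del i.+1) (del i)) lt => // [gt|->]; rewrite ?ltxx //.
  by rewrite ltNge ltW // fst // gt dN.
have [e2lt|e2gt|/esym e2_0] := ltgtP e2 0; last by rewrite e2_0 eqxx in e20.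
(* Here [del] decreases, and its reversal [rho] is the forbidden subsequence. *)
- pose rho i := del (n.-1 - i)%N.
  have ri : incr n rho.
    apply: incrP => i ilt; rewrite /rho.
    by rewrite (_ : n.-1 - i = (n.-1 - i.+1).+1)%N ?dgt //; lia.
  apply: (free rho ri) => [|j /andP[j0 jd]]; first by apply: dN; lia.
  have [e e0 He] := hs j.+1 jd.
  exists ((-1) ^+ perm (@rev_ord_inj j.+1) * e) => [|t ti tn].
    by rewrite mulf_neq0 // signr_eq0.
  (* The top differing digits of the tuple [t'] are [rho \o t], reversed. *)
  pose t' c := if (c <= j)%N then (n.-1 - t (j - c))%N else n.
  have tb c : (c <= j)%N -> (t c < n)%N.
    by move=> cj; apply: leq_ltn_trans tn; apply: (incr_le ti); rewrite cj ltnSn.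
  have t'i : incr j.+2 t'.
    apply: incrP => i; rewrite !ltnS /t' => ij; rewrite ij.
    case: ifP => [ij'|_]; last by lia.
    have := tb (j - i)%N; have := ti (j - i.+1)%N (j - i)%N; lia.
  (* By [level_decr] each digit depends only on the earlier index of its pair, so the last index of
     [t'] may be [n]. *)
  have dE c : (c <= j)%N -> delta (s \o t') c = rho (t (j - c)%N).
    move=> cj; have cc : (t' c < t' c.+1)%N by apply: t'i; rewrite ltnSn.
    rewrite /delta /= (@level_decr n) // => [|i ilt|]; last 1 first.
    - by rewrite cc /t'; case: ifP => _; lia.
    - by rewrite /t' cj.
    - exact: dgt.
  have mE : minor a j (delta (s \o t')) =
            (-1) ^+ perm (@rev_ord_inj j.+1) * minor a j (rho \o t).
    by rewrite (eq_minor a dE) -(minor_rev a j (rho \o t)).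
  have m0 : minor a j (rho \o t) != 0.
    apply: gp => //= [b c /andP[bc cj]|]; last by apply: dN; lia.
    by apply: ri; rewrite ti ?bc //= tb.
  have t'n : (t' j.+1 = n)%N by rewrite /t' ltnn.
  (* The sign of the reversal occurs twice and cancels. *)
  rewrite -(He t') ?t'n // sgE ?t'n // ?mE ?mulf_neq0 ?signr_eq0 //.
  by rewrite !mulr_sign; case: (odd_perm _); rewrite ?sgrN ?opprK.
have di : incr n del by apply: incrP => i ilt; apply: dlt.
apply: (free del di) => [|j /andP[j0 jd]]; first by apply: dN; lia.
have [e e0 He] := hs j.+1 jd.
exists e => // t ti tn.
(* The top differing digits of the tuple [t'] are [del \o t]. *)
pose t' c := if c is c'.+1 then (t c').+1 else 0%N.
have tb c : (c <= j)%N -> (t c < n)%N.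
  by move=> cj; apply: leq_ltn_trans tn; apply: (incr_le ti); rewrite cj ltnSn.
have t'i : incr j.+2 t'.
  by apply: incrP => -[|i] ij //; rewrite /t' ltnS ti // ltnSn.
(* By [level_incr] only the later index of each pair matters, so [t'] may start at 0. *)
have mE : minor a j (delta (s \o t')) = minor a j (del \o t).
  apply: eq_minor => c cj; rewrite /delta /= (level_incr si) //.
  by rewrite tb // andbT -ltnS; apply: (t'i c c.+1); rewrite ltnSn.
have m0 : minor a j (del \o t) != 0.
  apply: gp => //= [b c /andP[bc cj]|]; last by apply: dN.
  by apply: di; rewrite ti ?bc //= tb.
by rewrite -(He t') // sgE ?mE.
Qed.

(** Each step raises [d] and [n] together, so [n - d] stays fixed while the number of points is
    exponentiated. *)
Lemma bad_twr d n : (1 <= d)%N -> (d + 1 <= n)%N ->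
  exists a, bad a d n (twr d (n - d)).
Proof.
case: d => // d _; elim: d n => [|d IH] n hn.
  by exists (fun x r => x%:R ^+ r); rewrite /twr /= subn1; apply: bad_base; lia.
case: n hn => // n hn; have [|a ba] := IH n; first by lia.
by apply: (bad_step _ _ ba) => //; lia.
Qed.

End Bad.

(** * Back to points *)

Section Points.
Variables (R : realType) (a : nat -> nat -> R).
Hypothesis a0 : forall x, a x 0%N = 1.

Definition point d x : 'rV[R]_d := \row_(k < d) a x k.+1.

Lemma det_homog_matrix_point d j (hj : (j <= d)%N) (t : nat -> nat) :
  \det (homog_matrix (fun c : 'I_j.+1 => proj hj (point d (t c)))) = minor a j t.
Proof.
congr (\det _); apply/matrixP => r c; rewrite !mxE.
by case: unliftP => [k|] ->; rewrite ?mxE ?a0.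
Qed.

Lemma proj_id d (x : 'rV[R]_d) : proj (leqnn d) x = x.
Proof. by apply/rowP => k; rewrite mxE; congr (x _ _); apply: val_inj. Qed.

Lemma general_position_point d N m : (m <= N)%N ->
  (forall t, incr d.+1 t -> (t d < N)%N -> minor a d t != 0) ->
  general_position (fun i : 'I_m => point d i).
Proof.
move=> mN gp A cA [v [b [v0 vb]]].
pose f (c : 'I_d.+1) := enum_val (cast_ord (esym cA) c).
have finj : injective f by move=> x y /enum_val_inj /cast_ord_inj.
(* This lists [A] in increasing order, as [gp] requires. *)
have [t [h [ti fh]]] := increasing_enum_image finj.
have hinj : injective h by move=> x y hxy; apply: finj; rewrite !fh /= hxy.
have tA c : t c \in A.
  by rewrite -(f_invF hinj c) -[t _]/((t \o h) _) -fh enum_valP.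
pose t' c := t (inord c) : nat.
have t'i : incr d.+1 t' by move=> x y /andP[xy yd]; apply: ti; rewrite !inordK //; lia.
have := gp t' t'i (leq_trans (ltn_ord _) mN).
rewrite -(det_homog_matrix_point (leqnn d)) -unitfE -unitmxE; set M := homog_matrix _.
move=> uM.
(* The hyperplane becomes a left kernel vector of the invertible matrix [M]. *)
pose u : 'rV[R]_d.+1 := \row_r (if unlift ord0 r is Some k then v 0 k else - b).
have uM0 : u *m M = 0.
  apply/rowP => c; rewrite !mxE big_ord_recl !mxE unlift_none mulr1.
  apply/eqP; rewrite addrC subr_eq0 -(vb _ (tA c)); apply/eqP.
  by apply: eq_bigr => k _; rewrite !mxE liftK proj_id !mxE /t' inord_val.
have u0 : u = 0 by rewrite -(mulmxK uM u) uM0 mul0mx.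
case/negP: v0; apply/eqP/rowP => k.
by have /rowP/(_ (lift ord0 k)) := u0; rewrite !mxE liftK.
Qed.

Lemma super_ot_homogeneous_point d n m (s : 'I_n.+1 -> 'I_m) :
  super_ot_homogeneous (fun i => point d (s i)) ->
  forall j, (1 <= j <= d)%N -> homog a j n.+1 (fun i => s (inord i)).
Proof.
move=> hs j /andP[j1 jd]; have [e [e0 He]] := hs j jd j1.
exists e => // t ti tn.
have tb c : (c <= j)%N -> (t c < n.+1)%N.
  by move=> cj; apply: leq_ltn_trans tn; apply: (incr_le ti); rewrite cj ltnSn.
rewrite -(He (fun c => inord (t c))); last first.
  move=> b c bc; have cj := ltn_ord c; rewrite !inordK ?tb //; try by lia.
  by apply: ti; rewrite bc.
congr (Num.sg _).
by rewrite -(det_homog_matrix_point jd).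
Qed.

End Points.

Theorem theorem1p4 (R : realType) (d n : nat) (hd : (1 <= d)%N)
    (hn : (d + 1 <= n)%N) :
  (OTstar R d n >= twr d (n - d))%N.
Proof.
have [a [a0 gp _ free]] := bad_twr R hd hn.
rewrite /OTstar; case: ex_minnP => m /asboolP force _.
rewrite leqNgt; apply/negP => mN.
(* The first [m] points of the bad configuration would contain a homogeneous subsequence. *)
have gpm : general_position (fun i : 'I_m => point a d i).
  by apply: (general_position_point a0 (ltnW mN)) => t; apply: gp.
have [s [si hs]] := force _ gpm.
case: n hn {gp} free force s si hs mN => [|n] hn free force s si hs mN; first by lia.
apply: (free (fun i => s (inord i))) (super_ot_homogeneous_point a0 hs).
  by move=> b c /andP[bc cn]; apply: si; rewrite !inordK //; lia.
exact: leq_trans (ltn_ord _) (ltnW mN).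
Qed.
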